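(* Let $N\geqslant 1$. There is a dense $G_\delta$ subset $\mathcal P$ of the space $\mathcal C(\mathbb R^N)$ such that for each $X\in\mathcal P$ and each non-zero linear subspace $L\subset\mathbb R^N$, the orthogonal projection of $X$ into $L$ is a Cantor set.
   Context: A Cantor set is any topological space homeomorphic to the standard middle-thirds Cantor set (equivalently, a non-empty metrizable zero-dimensional compact space without isolated points). $\mathcal C(\mathbb R^N)$ is the set of all subsets of $\mathbb R^N$ that are Cantor sets, endowed with the topology of the Hausdorff metric $d_H(X,Y)=\inf\{\varepsilon>0 \mid X\subset O(Y,\varepsilon),\ Y\subset O(X,\varepsilon)\}$, where $O(X,\varepsilon)=\{y\in\mathbb R^N\mid d(y,X)<\varepsilon\}$ and $d$ is the Euclidean distance. *)

(* Defs.v *)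
From HB Require Import structures.
From mathcomp Require Import all_boot all_order all_algebra.
From mathcomp Require Import all_classical all_reals all_analysis.
From mathcomp Require Import ring lra.

Set Implicit Arguments.
Unset Strict Implicit.
Unset Printing Implicit Defensive.

Import Order.TTheory GRing.Theory Num.Theory.
Import numFieldNormedType.Exports.

Local Open Scope classical_set_scope.
Local Open Scope ring_scope.

Definition homeomorphic {T U : topologicalType} (A : set T) (B : set U) :=
  exists f : T -> U, exists g : U -> T,
    [/\ {within A, continuous f} /\ {within B, continuous g},
        {homo f : x / A x >-> B x}, {homo g : y / B y >-> A y},
        {in A, cancel f g} & {in B, cancel g f}].

Definition middle_thirds_step {R : realType} (C : set R) : set R :=
  [set x / 3 | x in C] `|` [set (x + 2) / 3 | x in C].

Definition middle_thirds (R : realType) : set R :=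
  \bigcap_n iter n middle_thirds_step `[0, 1]%classic.
Arguments middle_thirds R : clear implicits.

Definition is_cantor_set (R : realType) {T : topologicalType} (A : set T) :=
  homeomorphic A (middle_thirds R).

(* The library norm on 'rV[R]_N is the max norm; it induces the same topology
   as the Euclidean norm below, but not the same distance. *)

Section euclidean.
Variables (R : realType) (N : nat).
Implicit Types (u v w x y z : 'rV[R]_N) (X Y : set 'rV[R]_N).

Definition dot u v : R := \sum_i u 0 i * v 0 i.

Definition enorm u : R := Num.sqrt (dot u u).

Definition edistance u v : R := enorm (u - v).

Definition dist_to_set y X : R := inf [set edistance y x | x in X].

Definition nbhd_of X (e : R) : set 'rV[R]_N := [set y | dist_to_set y X < e].

Definition hausdorff_dist X Y : R :=
  inf [set e : R | [/\ 0 < e, X `<=` nbhd_of Y e & Y `<=` nbhd_of X e]].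

Definition orth_proj (L : {vspace 'rV[R]_N}) x : 'rV[R]_N :=
  xget 0 [set y | y \in L /\ forall z, z \in L -> dot (x - y) z = 0].

End euclidean.

Section euclidean_theory.
Variables (R : realType) (N : nat).
Implicit Types (u v w x y z : 'rV[R]_N) (X Y : set 'rV[R]_N).

Lemma dotC u v : dot u v = dot v u.
Proof. by apply: eq_bigr => i _; rewrite mulrC. Qed.

Lemma dotDl u v w : dot (u + v) w = dot u w + dot v w.
Proof. by rewrite -big_split; apply: eq_bigr => i _; rewrite mxE mulrDl. Qed.

Lemma dotZl a u w : dot (a *: u) w = a * dot u w.
Proof. by rewrite mulr_sumr; apply: eq_bigr => i _; rewrite mxE mulrA. Qed.

Lemma dot0l w : dot 0 w = 0.
Proof. by rewrite -(scale0r 0) dotZl mul0r. Qed.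

Lemma dotDr u v w : dot u (v + w) = dot u v + dot u w.
Proof. by rewrite dotC dotDl dotC [dot w _]dotC. Qed.

Lemma dotZr a u w : dot u (a *: w) = a * dot u w.
Proof. by rewrite dotC dotZl dotC. Qed.

Lemma dotNl u w : dot (- u) w = - dot u w.
Proof. by rewrite -scaleN1r dotZl mulN1r. Qed.

Lemma dotNr u w : dot u (- w) = - dot u w.
Proof. by rewrite -scaleN1r dotZr mulN1r. Qed.

Lemma dot_ge0 u : 0 <= dot u u.
Proof. by apply: sumr_ge0 => i _; rewrite -expr2 sqr_ge0. Qed.

Lemma dot_eq0 u : dot u u = 0 -> u = 0.
Proof.
move=> /eqP; rewrite psumr_eq0; last by move=> i _; rewrite -expr2 sqr_ge0.
move=> /allP u0; apply/rowP => i; rewrite mxE.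
by have := u0 i (mem_index_enum _); rewrite -expr2 sqrf_eq0 => /eqP.
Qed.

Lemma dotE u v : dot u v = (u *m v^T) 0 0.
Proof. by rewrite mxE; apply: eq_bigr => i _; rewrite mxE. Qed.

Lemma CauchySchwarz u v : dot u v ^+ 2 <= dot u u * dot v v.
Proof.
have [v0|v0] := eqVneq (dot v v) 0.
  by rewrite (dot_eq0 v0) dotC !dot0l expr0n /= mulr0.
have vv : 0 < dot v v by rewrite lt_neqAle eq_sym v0 dot_ge0.
have := dot_ge0 (dot v v *: u - dot u v *: v).
rewrite !(dotDl, dotDr, dotNl, dotNr, dotZl, dotZr) [dot v u]dotC => h.
have : 0 <= dot v v * (dot u u * dot v v - dot u v ^+ 2) by nra.
by rewrite pmulr_rge0 // subr_ge0.
Qed.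

Lemma enorm_ge0 u : 0 <= enorm u. Proof. exact: sqrtr_ge0. Qed.

Lemma enormN u : enorm (- u) = enorm u.
Proof. by rewrite /enorm dotNl dotNr opprK. Qed.

Lemma enormD u v : enorm (u + v) <= enorm u + enorm v.
Proof.
have sq w : enorm w ^+ 2 = dot w w by rewrite sqr_sqrtr // dot_ge0.
have uv : dot u v <= enorm u * enorm v.
  apply: le_trans (ler_norm _) _.
  rewrite -(@ler_pXn2r _ 2) ?nnegrE ?mulr_ge0 ?enorm_ge0 //.
  by rewrite real_normK ?num_real // exprMn !sq CauchySchwarz.
rewrite -(@ler_pXn2r _ 2) ?nnegrE ?addr_ge0 ?enorm_ge0 //.
rewrite sqrrD !sq !(dotDl, dotDr) [dot v u]dotC; lra.
Qed.

Lemma edistance_ge0 x y : 0 <= edistance x y. Proof. exact: enorm_ge0. Qed.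

Lemma edistancexx x : edistance x x = 0.
Proof. by rewrite /edistance subrr /enorm dot0l sqrtr0. Qed.

Lemma edistanceC x y : edistance x y = edistance y x.
Proof. by rewrite /edistance -enormN opprB. Qed.

Lemma edistance_eq0 x y : edistance x y = 0 -> x = y.
Proof.
move=> /eqP; rewrite sqrtr_eq0 => le0.
apply/eqP; rewrite -subr_eq0; apply/eqP; apply: dot_eq0.
by apply/le_anti; rewrite le0 dot_ge0.
Qed.

Lemma edistance_triangle y x z :
  edistance x z <= edistance x y + edistance y z.
Proof. by have := enormD (x - y) (y - z); rewrite addrA subrK. Qed.

Lemma edistance_continuous y : continuous (edistance y).
Proof.
have c i : continuous (fun x : 'rV[R]_N => (y - x) 0 i : R).
  have -> : (fun x : 'rV[R]_N => (y - x) 0 i : R) =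
      (fun x => y 0 i + (-1) * x 0 i).
    by apply/funext => t; rewrite !mxE mulN1r.
  move=> x; apply: (@continuousD _ _ _ (fun=> y 0 i : R)
    (fun x : 'rV[R]_N => (-1) * x 0 i : R)); first exact: cst_continuous.
  apply: (@continuousM _ _ (fun=> -1 : R) (fun x : 'rV[R]_N => x 0 i : R)).
    exact: cst_continuous.
  exact: coord_continuous.
have d (r : seq 'I_N) :
    continuous (fun x : 'rV[R]_N => \sum_(i <- r) (y - x) 0 i * (y - x) 0 i : R).
  elim: r => [|i r IHr] x.
    by under eq_fun do rewrite big_nil; exact: cst_continuous.
  under eq_fun do rewrite big_cons.
  apply: (@continuousD _ _ _ (fun x : 'rV[R]_N => (y - x) 0 i * (y - x) 0 i : R)
    (fun x => \sum_(i <- r) (y - x) 0 i * (y - x) 0 i)); last exact: IHr.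
  by apply: (@continuousM _ _ (fun x : 'rV[R]_N => (y - x) 0 i : R)
    (fun x : 'rV[R]_N => (y - x) 0 i : R)); exact: c.
move=> x; exact: (continuous_comp (d (index_enum 'I_N) x) (@sqrt_continuous R _)).
Qed.

Lemma nbhd_ofP X e y : X !=set0 ->
  nbhd_of X e y <-> exists2 x, X x & edistance y x < e.
Proof.
move=> [x0 Xx0]; split => [|[x Xx xe]].
  move=> /inf_lt -[]; first by exists (edistance y x0), x0.
  by move=> _ [x Xx <-] xe; exists x.
apply: le_lt_trans xe; apply: ge_inf; last by exists x.
by exists 0 => _ [z _ <-]; exact: edistance_ge0.
Qed.

Lemma orth_projP (L : {vspace 'rV[R]_N}) x :
  orth_proj L x \in L /\ forall z, z \in L -> dot (x - orth_proj L x) z = 0.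
Proof.
pose S := [set y | y \in L /\ forall z, z \in L -> dot (x - y) z = 0].
suff [y Sy] : exists y, S y by exact: (@xgetPex _ 0 S (ex_intro _ _ Sy)).
pose B : 'M[R]_(\dim L, N) := \matrix_i (vbasis L)`_i.
have mulB (c : 'rV_(\dim L)) : c *m B = \sum_i c 0 i *: (vbasis L)`_i.
  by rewrite mulmx_sum_row; apply: eq_bigr => i _; rewrite rowK.
have inL (c : 'rV_(\dim L)) : c *m B \in L.
  rewrite mulB; apply: memv_suml => i _; apply: memvZ.
  by apply: vbasis_mem; rewrite mem_nth // size_tuple.
have Gu : B *m B^T \in unitmx.
  rewrite -row_free_unit -kermx_eq0; apply/rowV0P => c /sub_kermxP cG.
  have cB0 : c *m B = 0.
    by apply: dot_eq0; rewrite dotE trmx_mul -mulmxA (mulmxA B) mulmxA cG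
      mul0mx mxE.
  have /freeP fr := basis_free (vbasisP L).
  apply/rowP => i; rewrite mxE.
  by apply: (fr (fun i => c 0 i)); rewrite -mulB.
exists (x *m B^T *m invmx (B *m B^T) *m B); split; first exact: inL.
move=> z /coord_vbasis zE.
have -> : z = (\row_i coord (vbasis L) i z) *m B.
  by rewrite mulB {1}zE; apply: eq_bigr => i _; rewrite mxE.
rewrite dotE trmx_mul mulmxA mulmxBl -(mulmxA _ B) mulmxKV // subrr.
by rewrite mul0mx mxE.
Qed.

Lemma orth_proj_unique (L : {vspace 'rV[R]_N}) x y : y \in L ->
  (forall z, z \in L -> dot (x - y) z = 0) -> orth_proj L x = y.
Proof.
move=> yL yo; have [pL po] := orth_projP L x.
have dL : orth_proj L x - y \in L by rewrite memvB.
apply/eqP; rewrite -subr_eq0; apply/eqP; apply: dot_eq0.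
have -> : dot (orth_proj L x - y) (orth_proj L x - y) =
    dot (x - y) (orth_proj L x - y) - dot (x - orth_proj L x) (orth_proj L x - y).
  by rewrite -dotNl -dotDl; congr dot; rewrite opprB [RHS]addrC addrA subrK.
by rewrite po // yo // subrr.
Qed.

End euclidean_theory.

Section cantor_set_theory.
Variable R : realType.

Lemma middle_thirds0 : middle_thirds R 0.
Proof.
move=> n _; elim: n => [|n IHn] /=; first by rewrite in_itv /= lexx ler01.
by left; exists 0 => //; rewrite mul0r.
Qed.

Lemma middle_thirds_compact : compact (middle_thirds R).
Proof.
have cpt n : compact (iter n (@middle_thirds_step R) `[0, 1]%classic).
  elim: n => [|n IHn] /=; first exact: segment_compact.
  apply: compactU; apply: continuous_compact => //;
    apply: continuous_subspaceT => x.
    by apply: cvgM; [exact: cvg_id | exact: cvg_cst].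
  apply: cvgM; last exact: cvg_cst.
  by apply: cvgD; [exact: cvg_id | exact: cvg_cst].
apply: (subclosed_compact _ (cpt 0%N)); last by move=> x /(_ 0%N); exact.
apply: closed_bigI => n _; apply: compact_closed; last exact: cpt.
exact: Rhausdorff.
Qed.

Lemma cantor_set_compact {T : topologicalType} (A : set T) :
  is_cantor_set R A -> compact A.
Proof.
move=> [f [g [[_ cg] fA gB fgK _]]].
have -> : A = g @` middle_thirds R.
  apply/seteqP; split=> [x Ax|_ [y By <-]]; last exact: gB.
  by exists (f x); [exact: fA | rewrite fgK // inE].
exact: continuous_compact middle_thirds_compact.
Qed.

Lemma cantor_set_nonempty {T : topologicalType} (A : set T) :
  is_cantor_set R A -> A !=set0.
Proof. by move=> [f [g [_ _ gB _ _]]]; exists (g 0); exact/gB/middle_thirds0. Qed.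

End cantor_set_theory.

Record cantor_sets (R : realType) (N : nat) := CantorSet {
  cantor_carrier :> set 'rV[R]_N ;
  cantor_carrierP : is_cantor_set R cantor_carrier }.

HB.instance Definition _ (R : realType) (N : nat) :=
  gen_eqMixin (cantor_sets R N).
HB.instance Definition _ (R : realType) (N : nat) :=
  gen_choiceMixin (cantor_sets R N).

Section cantor_sets_metric.
Variables (R : realType) (N : nat).
Implicit Types X Y Z : cantor_sets R N.

Let radii X Y : set R :=
  [set e : R | [/\ 0 < e, X `<=` nbhd_of Y e & Y `<=` nbhd_of X e]].

Let X0 X : (X : set _) !=set0.
Proof. exact: cantor_set_nonempty (cantor_carrierP X). Qed.

Let imcompact X y : compact (edistance y @` X).
Proof.
apply: continuous_compact; last exact: cantor_set_compact (cantor_carrierP X).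
exact/continuous_subspaceT/edistance_continuous.
Qed.

Let bounded X y : exists M, forall x, cantor_carrier X x -> edistance y x <= M.
Proof.
have [M [_ hM]] := compact_bounded (@imcompact X y).
exists (M + 1) => x Xx; apply: le_trans (ler_norm _) _.
by apply: hM; [rewrite ltrDl | exists x].
Qed.

Let radii_sub X Y : exists2 e, 0 < e & X `<=` nbhd_of Y e.
Proof.
have [y Yy] := X0 Y; have [M hM] := bounded X y.
exists (`|M| + 1) => [|x Xx]; first by rewrite ltr_wpDl.
apply/nbhd_ofP => //; exists y => //; rewrite edistanceC.
rewrite (le_lt_trans (hM _ Xx)) // (le_lt_trans (ler_norm _)) //.
by rewrite ltrDl.
Qed.

Let nbhd_mono X (e e' : R) : e <= e' -> nbhd_of X e `<=` nbhd_of X e'.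
Proof. by move=> ee' x /lt_le_trans; exact. Qed.

Let radii_up X Y (e e' : R) : e <= e' -> radii X Y e -> radii X Y e'.
Proof.
move=> ee' [e0 XY YX]; split; first exact: lt_le_trans ee'.
  by apply: subset_trans XY _; exact: nbhd_mono.
by apply: subset_trans YX _; exact: nbhd_mono.
Qed.

Let radiiP X Y : has_inf (radii X Y).
Proof.
split; last by exists 0 => e [/ltW].
have [e e0 XY] := radii_sub X Y; have [e' e0' YX] := radii_sub Y X.
exists (Num.max e e'); split; first by rewrite lt_max e0.
  by apply: subset_trans XY _; apply: nbhd_mono; rewrite le_max lexx.
by apply: subset_trans YX _; apply: nbhd_mono; rewrite le_max lexx orbT.
Qed.

Let radii_gt X Y e : hausdorff_dist X Y < e -> radii X Y e.
Proof.
move=> /inf_lt -[]; first by case: (radiiP X Y).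
by move=> e' re' /ltW ee'; exact: radii_up re'.
Qed.

Let radii_le X Y e : radii X Y e -> hausdorff_dist X Y <= e.
Proof. by move=> re; apply: ge_inf => //; case: (radiiP X Y). Qed.

Let distxx X : hausdorff_dist X X = 0.
Proof.
apply/eqP; rewrite eq_le; apply/andP; split; last first.
  by apply: lb_le_inf; [case: (radiiP X X) | move=> e [/ltW]].
apply/ler_addgt0Pl => e e0; rewrite addr0; apply: radii_le.
by split=> // x Xx; apply/nbhd_ofP => //; exists x; rewrite ?edistancexx.
Qed.

Let dist_sym X Y : hausdorff_dist X Y = hausdorff_dist Y X.
Proof.
by rewrite /hausdorff_dist; congr inf; apply/seteqP; split=> e [].
Qed.

Let nbhd_trans X Y Z e e' : X `<=` nbhd_of Y e -> Y `<=` nbhd_of Z e' ->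
  X `<=` nbhd_of Z (e + e').
Proof.
move=> XY YZ x /XY /nbhd_ofP -[] // y /YZ /nbhd_ofP -[] // z Zz yz xy.
apply/nbhd_ofP => //; exists z => //.
by apply: le_lt_trans (edistance_triangle y _ _) _; rewrite ltrD.
Qed.

Let dist_triangle Y X Z :
  hausdorff_dist X Z <= hausdorff_dist X Y + hausdorff_dist Y Z.
Proof.
apply/ler_addgt0Pl => e e0.
have /radii_gt[a0 XY YX] : hausdorff_dist X Y < hausdorff_dist X Y + e / 2.
  by rewrite ltrDl divr_gt0.
have /radii_gt[b0 YZ ZY] : hausdorff_dist Y Z < hausdorff_dist Y Z + e / 2.
  by rewrite ltrDl divr_gt0.
have -> : e + (hausdorff_dist X Y + hausdorff_dist Y Z) =
    (hausdorff_dist X Y + e / 2) + (hausdorff_dist Y Z + e / 2) by field.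
apply: radii_le; split; first by rewrite addr_gt0.
  exact: nbhd_trans XY YZ.
by rewrite addrC; exact: nbhd_trans ZY YX.
Qed.

Let dist0_sub X Y : hausdorff_dist X Y = 0 -> X `<=` Y.
Proof.
move=> d0 x Xx.
have : closed (edistance x @` Y).
  by apply: compact_closed; [exact: Rhausdorff | exact: imcompact].
rewrite closure_id => cl.
have : (edistance x @` Y) 0.
  rewrite cl => B /nbhs_ballP[e /= e0 Be].
  have [_ /(_ x Xx) + _] : radii X Y e by apply: radii_gt; rewrite d0.
  move=> /nbhd_ofP -[] // y Yy xy; exists (edistance x y).
  split; first by exists y.
  by apply: Be; rewrite /ball /= sub0r normrN ger0_norm ?edistance_ge0.
by move=> [y Yy /edistance_eq0 ->].
Qed.

Let dist_positivity X Y : hausdorff_dist X Y = 0 -> X = Y.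
Proof.
move=> d0; have XY : cantor_carrier X = cantor_carrier Y.
  by apply/seteqP; split; apply: dist0_sub => //; rewrite dist_sym.
case: X Y {d0} XY => [X hX] [Y hY] /= XY; subst Y.
by congr CantorSet; exact: Prop_irrelevance.
Qed.

HB.instance Definition _ := @isMetric.Build R (cantor_sets R N)
  (fun X Y => hausdorff_dist X Y) distxx dist_positivity dist_sym dist_triangle.

Lemma mdist_cantor_sets X Y : mdist X Y = hausdorff_dist X Y.
Proof. by []. Qed.

End cantor_sets_metric.

(* Main.v *)
(* Call a compact set thin if it is covered by finitely many balls of equal radius and
   arbitrarily small total radius, and spread if at arbitrarily small scales each of its points
   can be moved within the set almost exactly along each coordinate axis. At each fixed scale both
   conditions survive small Hausdorff perturbations, so imposing them at the scales 2^-k defines a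
   Gdelta set.

   Orthogonal projections are 1-Lipschitz, hence preserve thinness, and a thin set is
   zero-dimensional because around each point there are arbitrarily small spheres that miss it.
   Spreadness forbids open pieces inside affine hyperplanes, so projections to nonzero subspaces
   have no isolated points. By Brouwer's characterization the projections are Cantor sets; for the
   full space this shows that every nonempty compact thin and spread set is itself a Cantor set.

   Density then needs no Baire category argument: any X is close to the closure of the set of sums
   f + sum_(k <= l < m) b_l 4^-l e_(l mod N), with f in a finite net of X and bits b_l, which is
   thin as 2^M 4^-M -> 0 and spread since flipping one bit moves a point along one axis. *)
From HB Require Import structures.
Require Import Defs.
From mathcomp Require Import all_boot all_order all_algebra.
From mathcomp Require Import all_classical all_reals all_analysis borel_hierarchy.
From mathcomp Require Import ring lra zify.

Import Order.TTheory GRing.Theory Num.Theory.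
Import numFieldNormedType.Exports.

Local Open Scope classical_set_scope.
Local Open Scope ring_scope.

Set Implicit Arguments.
Unset Strict Implicit.

(** * Brouwer's characterization of the Cantor space *)

Lemma compact_set_type (T : topologicalType) (A : set T) :
  compact A -> compact [set: set_type A].
Proof.
move=> cA F FF _.
have GA : (set_val @ F) A.
  by apply: (@filterS _ F _ setT) => [y _|]; [exact: set_valP|exact: filterT].
have [x [Ax clx]] := cA (set_val @ F) _ GA.
exists (exist _ x (mem_set Ax)); split=> // B U FB.
move=> [_ [[W oW <-] /= Wx WU]].
have GB : (set_val @ F) (set_val @` B).
  by apply: (@filterS _ F) FB => z Bz; exists z.
have [y [[z Bz zy] Wy]] := clx _ _ GB (open_nbhs_nbhs (conj oW Wx)).
by exists z; split=> //; apply: WU; rewrite /= zy.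
Qed.

(* As [phi] does not vanish on [A], the points of [A] where [phi < 0] form a clopen subset. *)
Lemma cantor_space_parametrization (R : realType) (T : pseudoMetricType R)
    (A : set T) :
    hausdorff_space T -> A !=set0 -> compact A ->
    (forall x, A x -> forall U, nbhs x U -> exists y, [/\ A y, U y & y != x]) ->
    (forall x y, A x -> A y -> x != y -> exists phi : T -> R,
      [/\ continuous phi, phi x < 0, 0 < phi y & forall a, A a -> phi a != 0]) ->
  exists2 h : cantor_space -> T, continuous h /\ injective h & range h = A.
Proof.
move=> hT [a0 Aa0] cA perfA zA.
(* The subspace [A] becomes a pointed type of its own, to which the homeomorphism theorem for
   [cantor_like] spaces applies. *)
pose pA : pseudoPMetricType R :=
  HB.pack_for (pseudoPMetricType R) (set_type A)
   (isPointed.Build (set_type A) (exist _ a0 (mem_set Aa0))).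
have val_cont : continuous (set_val : set_type A -> T) by exact: initial_continuous.
have val_inj : injective (set_val : set_type A -> T) by exact: val_inj.
have open_val (U : set (set_type A)) (V : set T) : open V ->
    (forall x : set_type A, U x <-> V (set_val x)) -> open U.
  move=> oV UV; exists V => //; apply/seteqP; split=> x; exact: (UV x).2 || exact: (UV x).1.
have cantorA : cantor_like pA.
  split.
  - split; first exact: closedT.
    apply/seteqP; split=> // -[x xA] _ U [_ [[W oW <-] /= Wx WU]].
    have [y [Ay Wy yx]] := perfA x (set_mem xA) W (open_nbhs_nbhs (conj oW Wx)).
    exists (exist _ y (mem_set Ay)); split=> //; last exact: WU.
  - exact: compact_set_type.
  - move=> x y xy; apply: val_inj; apply: hT => U V Ux Vy.
    have [z [Uz Vz]] := xy _ _ (val_cont x _ Ux) (val_cont y _ Vy).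
    by exists (set_val z).
  - move=> [x xA] [y yA] xy.
    have [|phi [cphi phix phiy phiA]] := zA x y (set_mem xA) (set_mem yA).
      by apply: (contra_neq _ xy) => e; exact: val_inj.
    exists (set_val @^-1` (phi @^-1` [set t | t < 0])); split=> //=; last first.
      by apply/negP; rewrite -leNgt ltW.
    split.
      apply: (open_val _ (phi @^-1` [set t | t < 0])) => //.
      by apply: open_comp => // t _; exact: cphi.
    rewrite -openC; apply: (open_val _ (phi @^-1` [set t | t > 0])) => [|[z zP]].
      by apply: open_comp => // t _; exact: cphi.
    have /= nz := phiA z (set_mem zP).
    split=> /= [/negP|h]; last by apply/negP; rewrite -leNgt ltW.
    by rewrite -leNgt le_eqVlt eq_sym (negPf nz).
have [f [cf _]] := homeomorphism_cantor_like cantorA.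
exists (set_val \o f); first split.
- move=> x; apply: continuous_comp; [exact: cf | exact: val_cont].
- move=> x y /val_inj /inj; apply; exact: in_setT.
- apply/seteqP; split=> [_ [x _ <-]|y Ay] /=; first exact: set_valP.
  have [x _ fx] := @surj _ _ _ _ f (exist _ y (mem_set Ay)) I.
  by exists x => //=; rewrite fx.
Qed.

(** A continuous map from a compact space to a Hausdorff space is closed: the complement of an open
    neighbourhood of [k] has a closed image, which misses [h k]. *)
Lemma continuous_inverse_within (K T : topologicalType) (h : K -> T)
    (g : T -> K) : compact [set: K] -> hausdorff_space T ->
  continuous h -> cancel h g -> {within range h, continuous g}.
Proof.
move=> cK hT ch hK.
apply/subspace_continuousP => _ [k _ <-] U; rewrite [from_subspace _ _ _]hK => Uk.
have clF : closed (h @` ~` U°).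
  apply: compact_closed hT _; apply: continuous_compact.
    exact: continuous_subspaceT.
  apply: subclosed_compact cK (@subsetT _ _).
  exact/open_closedC/open_interior.
have hk : nbhs (h k) (~` (h @` ~` U°)).
  apply: open_nbhs_nbhs; split; first exact: closed_openC.
  by move=> [l Ul /(can_inj hK) lk]; apply: Ul; rewrite lk.
apply: filterS hk => y /= yF [l _ hl]; rewrite -hl [from_subspace _ _ _]hK.
by apply: interior_subset; apply: contrapT => Ul; apply: yF; exists l.
Qed.

Lemma cantor_param_homeomorphic (T U : topologicalType) (A : set T) (B : set U)
    (a : cantor_space -> T) (b : cantor_space -> U) :
    hausdorff_space T -> hausdorff_space U ->
    continuous a -> injective a -> range a = A ->
    continuous b -> injective b -> range b = B ->
  homeomorphic A B.
Proof.
move=> hT hU ca ia <- cb ib <-.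
have cK := cantor_space_compact.
pose a' := 'pinv_(fun=> point) setT a; pose b' := 'pinv_(fun=> point) setT b.
have aK : cancel a a' by move=> x; apply: pinvKV (in_setT x); exact: in2W.
have bK : cancel b b' by move=> x; apply: pinvKV (in_setT x); exact: in2W.
exists (b \o a'), (a \o b'); split.
- split.
    apply: within_continuous_comp; first by move=> x _; exact: cb.
    exact: continuous_inverse_within.
  apply: within_continuous_comp; first by move=> x _; exact: ca.
  exact: continuous_inverse_within.
- by move=> _ [x _ <-] /=; exists (a' (a x)).
- by move=> _ [x _ <-] /=; exists (b' (b x)).
- by move=> y; rewrite inE => -[x _ <-] /=; rewrite aK bK.
- by move=> y; rewrite inE => -[x _ <-] /=; rewrite bK aK.
Qed.

(** * The middle-thirds set *)

Section middle_thirds_is_cantor.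
Variable R : realType.
Local Notation C := (middle_thirds R).
Implicit Types x y : R.

Lemma middle_thirds_subset01 x : C x -> 0 <= x <= 1.
Proof. by move=> /(_ 0%N I); rewrite /= in_itv. Qed.

Lemma middle_thirds_left x : C x -> C (x / 3).
Proof.
move=> Cx [|n] _ /=; last by left; exists x => //; exact: Cx.
by have /andP[x0 x1] := middle_thirds_subset01 Cx; rewrite in_itv /=; lra.
Qed.

Lemma middle_thirds_right x : C x -> C ((x + 2) / 3).
Proof.
move=> Cx [|n] _ /=; last by right; exists x => //; exact: Cx.
by have /andP[x0 x1] := middle_thirds_subset01 Cx; rewrite in_itv /=; lra.
Qed.

Lemma middle_thirds_step01 n x : iter n middle_thirds_step `[0, 1]%classic x ->
  0 <= x <= 1.
Proof.
elim: n x => [|n IHn] x /=; first by rewrite in_itv.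
by move=> [] [y /IHn /andP[y0 y1] <-]; lra.
Qed.

(** At every stage the left copy lies in [0, 1/3] and the right one in [2/3, 1], so comparing [x]
    with 1/2 selects the same copy at all stages. *)
Lemma middle_thirdsP x : C x ->
  exists2 y, C y & x = y / 3 \/ x = (y + 2) / 3.
Proof.
move=> Cx; have [x2|x2] := ltP x 2^-1.
- exists (3 * x); last by left; field.
  move=> n _; have [[y ny <-]|[y /middle_thirds_step01 /andP[y0 y1] yx]] := Cx n.+1 I.
    by rewrite (_ : 3 * (y / 3) = y) //; field.
  by exfalso; lra.
- exists (3 * x - 2); last by right; field.
  move=> n _; have [[y /middle_thirds_step01 /andP[y0 y1] yx]|[y ny <-]] := Cx n.+1 I.
    by exfalso; lra.
  by rewrite (_ : 3 * ((y + 2) / 3) - 2 = y) //; field.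
Qed.

(** At scale 1, one of 0 and 1 differs from [x]. Self-similarity then divides the distance by 3 at
    each step. *)
Lemma middle_thirds_perfect n x : C x ->
  exists2 y, C y & y != x /\ `|y - x| <= 3 ^- n.
Proof.
elim: n x => [|n IHn] x Cx.
  have C1 : C 1.
    elim=> [|n IHn] _ /=; first by rewrite in_itv /= lexx ler01.
    by right; exists 1; [exact: IHn | field].
  have /andP[x0 x1] := middle_thirds_subset01 Cx; rewrite expr0 invr1.
  have [->|xn0] := eqVneq x 0; first by exists 1 => //; rewrite oner_neq0 subr0 normr1.
  exists 0; first exact: middle_thirds0.
  by rewrite eq_sym xn0 sub0r normrN ger0_norm.
have [y Cy xy] := middle_thirdsP Cx; have [z Cz [zy zyn]] := IHn y Cy.
case: xy => ->; [exists (z / 3); first exact: middle_thirds_left|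
                 exists ((z + 2) / 3); first exact: middle_thirds_right];
  (split; first by apply: contra_neq zy => e; lra).
- rewrite -mulrBl normrM exprSr invfM [X in _ * X]gtr0_norm ?invr_gt0 //.
  by rewrite ler_wpM2r // invr_ge0.
- rewrite -mulrBl opprD addrACA subrr addr0 normrM exprSr invfM.
  by rewrite [X in _ * X]gtr0_norm ?invr_gt0 // ler_wpM2r // invr_ge0.
Qed.

(** Points in different thirds are separated by 1/2. Points in the same third are expanded by 3, and
    the gap found by induction is pulled back. *)
Lemma middle_thirds_gap n x y : C x -> C y -> 3 ^- n < y - x ->
  exists2 z, x < z < y & ~ C z.
Proof.
elim: n x y => [|n IHn] x y Cx Cy.
  rewrite expr0 invr1; have := middle_thirds_subset01 Cx.
  by have := middle_thirds_subset01 Cy; lra.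
have n0 : 0 < 3 ^- n :> R by rewrite invr_gt0 exprn_gt0.
rewrite exprSr invfM => nxy.
have mid : ~ C 2^-1.
  by move=> /middle_thirdsP[z /middle_thirds_subset01]; lra.
have [x' Cx' ex] := middle_thirdsP Cx; have [y' Cy' ey] := middle_thirdsP Cy.
have /andP[x0 x1] := middle_thirds_subset01 Cx'.
have /andP[y0 y1] := middle_thirds_subset01 Cy'.
case: ex nxy => ->; case: ey => -> nxy.
- have [|z xzy Cz] := IHn _ _ Cx' Cy'; first lra.
  exists (z / 3); first lra.
  move=> /middle_thirdsP[w Cw]; move: (middle_thirds_subset01 Cw) => /andP[w0 w1].
  move=> [] e; last lra.
  by apply: Cz; rewrite (_ : z = w) //; lra.
- by exists 2^-1 => //; lra.
- by exfalso; lra.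
- have [|z xzy Cz] := IHn _ _ Cx' Cy'; first lra.
  exists ((z + 2) / 3); first lra.
  move=> /middle_thirdsP[w Cw]; move: (middle_thirds_subset01 Cw) => /andP[w0 w1].
  move=> [] e; first lra.
  by apply: Cz; rewrite (_ : z = w) //; lra.
Qed.

Lemma exists_expVn_lt (b e : R) : 2 <= b -> 0 < e -> exists n, b ^- n < e.
Proof.
move=> b2 e0; exists (Num.bound e^-1); rewrite invf_plt ?posrE ?exprn_gt0 //.
  apply: lt_le_trans (upper_nthrootP (leqnn _)) _.
  by rewrite lerXn2r // nnegrE //; lra.
by lra.
Qed.

Lemma middle_thirds_parametrization :
  exists2 h : cantor_space -> R, continuous h /\ injective h & range h = C.
Proof.
have three : (2 : R) <= 3 by lra.
apply: (@cantor_space_parametrization R).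
- exact: Rhausdorff.
- by exists 0; exact: middle_thirds0.
- exact: middle_thirds_compact.
- move=> x Cx U /nbhs_ballP[e /= e0 eU].
  have [n ne] := exists_expVn_lt three e0.
  have [y Cy [yx yxn]] := middle_thirds_perfect n Cx.
  exists y; split=> //; apply: eU; rewrite /ball /= distrC.
  exact: le_lt_trans ne.
(* A point [z] of a gap between [x] and [y] gives an affine function vanishing only at [z], with its
   sign chosen to be negative at [x]. *)
- move=> x y Cx Cy; rewrite neq_lt => /orP[] xy.
    have [|n ne] := @exists_expVn_lt _ (y - x) three; first by rewrite subr_gt0.
    have [z /andP[xz zy] Cz] := middle_thirds_gap Cx Cy ne.
    exists (fun w => w - z); split; rewrite ?subr_lt0 ?subr_gt0 //.
      by move=> w; apply: cvgB; [exact: cvg_id|exact: cvg_cst].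
    by move=> w Cw; rewrite subr_eq0; apply: contra_notN Cz => /eqP <-.
  have [|n ne] := @exists_expVn_lt _ (x - y) three; first by rewrite subr_gt0.
  have [z /andP[xz zy] Cz] := middle_thirds_gap Cy Cx ne.
  exists (fun w => z - w); split; rewrite ?subr_lt0 ?subr_gt0 //.
    by move=> w; apply: cvgB; [exact: cvg_cst|exact: cvg_id].
  by move=> w Cw; rewrite subr_eq0; apply: contra_notN Cz => /eqP ->.
Qed.

Lemma is_cantor_setP (T : pseudoMetricType R) (A : set T) :
    hausdorff_space T -> A !=set0 -> compact A ->
    (forall x : T, A x -> forall U, nbhs x U -> exists y : T, [/\ A y, U y & y != x]) ->
    (forall x y : T, A x -> A y -> x != y -> exists phi : T -> R,
      [/\ continuous phi, phi x < 0, 0 < phi y & forall a, A a -> phi a != 0]) ->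
  is_cantor_set R A.
Proof.
move=> hT A0 cA pA zA.
have [h [ch ih] hA] := cantor_space_parametrization hT A0 cA pA zA.
have [k [ck ik] kC] := middle_thirds_parametrization.
by apply: cantor_param_homeomorphic ch ih hA ck ik kC => //; exact: Rhausdorff.
Qed.
End middle_thirds_is_cantor.

(** * Thin and spread sets *)

Section thin_spread.
Variables (R : realType) (N : nat).
Implicit Types (x y z u v : 'rV[R]_N) (A B : set 'rV[R]_N) (e : R).

Lemma ler_coord_enorm v i : `|v 0 i| <= enorm v.
Proof.
rewrite -(@ler_pXn2r _ 2) ?nnegrE ?normr_ge0 ?enorm_ge0 //.
rewrite real_normK ?num_real // sqr_sqrtr ?dot_ge0 // expr2.
by rewrite /dot (bigD1 i) //= lerDl sumr_ge0 // => j _; rewrite -expr2 sqr_ge0.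
Qed.

Lemma norm_le_enorm v : `|v| <= enorm v.
Proof.
have [->|v0] := eqVneq v 0; first by rewrite normr0 enorm_ge0.
have [|[i j] /= vij] := @mx_norm_neq0 _ _ _ v; first by rewrite -[mx_norm v]/`|v| normr_eq0.
by rewrite [leLHS]vij ord1 ler_coord_enorm.
Qed.

(** Bridges the max norm, which defines the topology, and the Euclidean distance, in which all
    estimates below are made. *)
Lemma nbhs_edistance x (U : set 'rV[R]_N) : nbhs x U <->
  exists2 e, 0 < e & forall y, edistance x y < e -> U y.
Proof.
split=> [/nbhs_ballP[e /= e0 eU]|[e e0 eU]].
  exists e => // y xy; apply: eU.
  by rewrite -ball_normE /=; apply: le_lt_trans (norm_le_enorm _) xy.
have xe : edistance x x < e by rewrite edistancexx.
by apply: filterS (cvgr_lt _ (@edistance_continuous _ _ x x) _ xe).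
Qed.

(** The successor on [size s] makes room for one more radius than there are balls, for the
    pigeonhole in [thin_sphere]. Centres may lie outside [A], so they can be kept when [A] is
    perturbed. *)
Definition thin_at e A := exists s : seq 'rV[R]_N, exists2 d, 0 < d &
  (size s).+1%:R * d < e /\
  forall a, A a -> exists2 c, c \in s & edistance c a < d.

(** Here [t] is the length of the move and [s] bounds its error. The factor [N] lets the move
    outweigh the errors of all [N] coordinates together in a dot product. *)
Definition spread_at e A (i : 'I_N) := exists t s, [/\ N%:R * s < t, t + s < e &
  forall a, A a -> exists2 b, A b & exists2 c, `|c| = t &
    edistance b (a + c *: delta_mx 0 i) < s].

Definition thin A := forall e, 0 < e -> thin_at e A.
Definition spread A := forall e i, 0 < e -> spread_at e A i.

(* Some of the [size s + 1] radii [d, 3 d, 5 d, ...] differs from all the distances from [x] to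
   [A], as each point of [s] rules out at most one of them. *)
Lemma thin_sphere A x e : thin A -> 0 < e ->
  exists2 r, 0 < r < e & forall a, A a -> edistance x a != r.
Proof.
move=> /(_ (e / 2)) + e0; rewrite divr_gt0 // => /(_ isT)[s [d d0 [sde cov]]].
pose r (k : 'I_(size s).+1) : R := (k.*2.+1)%:R * d.
have r0 k : 0 < r k by rewrite mulr_gt0 ?ltr0n.
(* The largest radius is [(2 size s + 1) d], whence the choice of [e / 2] above. *)
have re k : r k < e.
  have : r k <= (size s).+1%:R * 2 * d.
    by rewrite ler_pM2r // -natrM ler_nat muln2 doubleS ltnS ltnW // !ltnS leq_double -ltnS.
  lra.
(* Each point of [A] is less than [d] away from a centre, so it suffices that all centres keep
   distance at least [d] from the sphere. *)
suff [k kP] : exists k, forall c, c \in s -> d <= `|edistance x c - r k|.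
  exists (r k) => [|a /cov[c /kP kc ca]]; first by rewrite r0 re.
  apply: contraTneq kc => ra; rewrite -ltNge -ra; apply: le_lt_trans ca.
  have := edistance_triangle a x c; have := edistance_triangle c x a.
  by rewrite (edistanceC a c) ler_norml => *; apply/andP; split; lra.
apply: contrapT => /forallNP kP.
have kS k : exists j : 'I_(size s), `|edistance x (s`_j) - r k| < d.
  have /existsNP[c /not_implyP[cs /negP]] := kP k; rewrite -ltNge => h.
  have cs' : (index c s < size s)%N by rewrite index_mem.
  by exists (Ordinal cs'); rewrite /= nth_index.
have [f fP] := choice kS.
have : injective f.
  move=> k l fkl; have := fP k; have := fP l; rewrite fkl.
  set D := edistance _ _ => h1 h2.
  apply: val_inj; apply/eqP; rewrite eqn_leq.
  have aux (p q : 'I_(size s).+1) : `|D - r p| < d -> `|D - r q| < d -> (p <= q)%N.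
    rewrite !ltr_norml => hp hq; rewrite leqNgt; apply/negP => qp.
    have : (q.*2.+1)%:R * d + 2 * d <= (p.*2.+1)%:R * d.
      by rewrite -mulrDl -natrD ler_pM2r // ler_nat; lia.
    by rewrite /r in hp hq; lra.
  by rewrite !aux.
by move=> /leq_card; rewrite !card_ord ltnn.
Qed.

(** * Orthogonal projections of thin and spread sets *)

Lemma orth_projB (L : {vspace 'rV[R]_N}) x y :
  orth_proj L (x - y) = orth_proj L x - orth_proj L y.
Proof.
have [xL xo] := orth_projP L x; have [yL yo] := orth_projP L y.
apply: orth_proj_unique => [|z zL]; first exact: memvB.
have -> : x - y - (orth_proj L x - orth_proj L y) =
    (x - orth_proj L x) - (y - orth_proj L y).
  by rewrite !opprD !opprK addrACA.
by rewrite dotDl dotNl xo // yo // subrr.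
Qed.

Lemma orth_proj_dot (L : {vspace 'rV[R]_N}) x u : u \in L ->
  dot (orth_proj L x) u = dot x u.
Proof.
move=> uL; have [_ /(_ u uL)] := orth_projP L x.
by rewrite dotDl dotNl => /eqP; rewrite subr_eq0 => /eqP.
Qed.

(** Pythagoras: [0 <= |x - p|^2 = |x|^2 - |p|^2] for the projection [p] of [x]. *)
Lemma enorm_orth_proj (L : {vspace 'rV[R]_N}) x : enorm (orth_proj L x) <= enorm x.
Proof.
rewrite ler_sqrt ?dot_ge0 //; have [pL po] := orth_projP L x.
have := dot_ge0 (x - orth_proj L x).
by rewrite dotDr dotNr (po _ pL) subr0 dotDl dotNl [dot (orth_proj L x) x]dotC
  -(orth_proj_dot x pL) subr_ge0.
Qed.

Lemma edistance_orth_proj (L : {vspace 'rV[R]_N}) x y :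
  edistance (orth_proj L x) (orth_proj L y) <= edistance x y.
Proof. by rewrite /edistance -orth_projB enorm_orth_proj. Qed.

Lemma orth_proj_continuous (L : {vspace 'rV[R]_N}) : continuous (orth_proj L).
Proof.
move=> x U /nbhs_edistance[e e0 eU]; apply/nbhs_edistance; exists e => // y xy.
by apply: eU; apply: le_lt_trans (edistance_orth_proj L x y) xy.
Qed.

Lemma thin_orth_proj (L : {vspace 'rV[R]_N}) A : thin A -> thin (orth_proj L @` A).
Proof.
move=> tA e /tA[s [d d0 [sde cov]]].
exists (map (orth_proj L) s), d => //; rewrite size_map; split=> // _ [a Aa <-].
have [c cs ca] := cov a Aa; exists (orth_proj L c); first exact: map_f.
exact: le_lt_trans (edistance_orth_proj L _ _) ca.
Qed.

Lemma enorm_scale_delta (c : R) i : enorm (c *: delta_mx 0 i : 'rV[R]_N) = `|c|.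
Proof.
rewrite /enorm dotZl dotZr (_ : dot _ _ = 1) ?mulr1 -?expr2 ?sqrtr_sqr //.
rewrite /dot (bigD1 i) //= !mxE !eqxx mulr1 big1 ?addr0 // => j ji.
by rewrite !mxE (negPf ji) andbF mulr0.
Qed.

Lemma dot_delta (u : 'rV[R]_N) i : dot (delta_mx 0 i) u = u 0 i.
Proof.
rewrite /dot (bigD1 i) //= !mxE !eqxx mul1r big1 ?addr0 // => j ji.
by rewrite !mxE (negPf ji) andbF mul0r.
Qed.

(* Moving along the axis on which [u] has its largest coordinate changes [dot _ u] by more than
   the error of the move can compensate for. *)
Lemma spread_dot A a u e : spread A -> A a -> u != 0 -> 0 < e ->
  exists2 b, A b & edistance a b < e /\ dot (b - a) u != 0.
Proof.
move=> sA Aa u0 e0.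
have [i ui] : exists i, forall j, `|u 0 j| <= `|u 0 i|.
  have [|[k i] /= uki] := @mx_norm_neq0 _ _ _ u.
    by rewrite -[mx_norm u]/`|u| normr_eq0.
  have [j _ uj] := @Order.TotalTheory.arg_maxP _ _ _ i xpredT (fun j => `|u 0 j|) isT.
  by exists j => l; exact: uj.
have ui0 : 0 < `|u 0 i|.
  rewrite normr_gt0; apply: contra_neq u0 => ui0; apply/rowP => j; rewrite mxE.
  by apply/eqP; rewrite -normr_le0 (le_trans (ui j)) // ui0 normr0.
have [t [s [Nst tse /(_ a Aa)[b Ab [c ct bs]]]]] := sA e i e0.
exists b => //; split.
  rewrite edistanceC.
  apply: le_lt_trans (edistance_triangle (a + c *: delta_mx 0 i) _ _) _.
  by rewrite {2}/edistance addrAC subrr add0r enorm_scale_delta ct; lra.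
set w := b - (a + c *: delta_mx 0 i) in bs.
have -> : b - a = w + c *: delta_mx 0 i by rewrite /w opprD addrA subrK.
(* If the dot product vanished, then [t |u_i| = |dot w u| <= N s |u_i|], against [N s < t]. *)
rewrite dotDl dotZl dot_delta; apply/eqP => /eqP; rewrite addrC addr_eq0 => /eqP cu.
have : `|dot w u| <= \sum_(j < N) s * `|u 0 i|.
  apply: le_trans (ler_norm_sum _ _ _) _; apply: ler_sum => j _; rewrite normrM.
  by apply: ler_pM => //; apply: le_trans (ler_coord_enorm _ _) (ltW bs).
rewrite -normrN -cu normrM ct sumr_const card_ord -mulr_natl mulrA.
by rewrite ler_pM2r // leNgt Nst.
Qed.

Lemma cantor_orth_proj A (L : {vspace 'rV[R]_N}) :
    A !=set0 -> compact A -> thin A -> spread A -> L != 0%VS ->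
  is_cantor_set R (orth_proj L @` A).
Proof.
move=> [a0 Aa0] cA tA sA L0.
apply: is_cantor_setP.
- exact: norm_hausdorff.
- by exists (orth_proj L a0), a0.
- apply: continuous_compact cA; apply: continuous_subspaceT.
  exact: orth_proj_continuous.
- move=> _ [a Aa <-] U /nbhs_edistance[e e0 eU].
  (* For [u] in [L], [dot _ u] factors through the projection, so a nearby point with another value
     of it has another projection. *)
  have u0 : vpick L != 0 by rewrite vpick0.
  have [b Ab [abe bau]] := spread_dot sA Aa u0 e0.
  exists (orth_proj L b); split; first by exists b.
    by apply: eU; apply: le_lt_trans (edistance_orth_proj L a b) abe.
  apply: contraNneq bau => pab.
  rewrite -(@orth_proj_dot L) ?memv_pick //.
  by rewrite orth_projB pab subrr dot0l.
- move=> x y _ _ xy.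
  (* A sphere around [x] that misses the projection and leaves [y] outside yields the separating
     function. *)
  have [|r /andP[r0 rxy] rA] := @thin_sphere _ x (edistance x y) (thin_orth_proj L tA).
    by rewrite lt_neqAle edistance_ge0 andbT eq_sym; apply: contra_neq xy => /edistance_eq0.
  exists (fun z => edistance x z - r); split.
  + by move=> z; apply: (@continuousB _ _ _ (edistance x : _ -> R) (fun=> r));
      [exact: edistance_continuous|exact: cst_continuous].
  + by rewrite edistancexx sub0r oppr_lt0.
  + by rewrite subr_gt0.
  + by move=> a Aa; rewrite subr_eq0 rA.
Qed.
End thin_spread.

(** * Stability of thinness and spreadness under small Hausdorff perturbations *)

Section near.
Variables (R : realType) (N : nat).
Implicit Types (x y z u v : 'rV[R]_N) (A B : set 'rV[R]_N) (e : R).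

(** One half of the Hausdorff condition, without the infimum hidden in [nbhd_of]. *)
Definition within_nbhd e A B := forall a, A a -> exists2 b, B b & edistance a b < e.

(** The same centres serve for [B]: the strict bound on the total radius allows each ball to grow by
    half of the slack. *)
Lemma thin_at_near e A : thin_at e A ->
  exists2 r, 0 < r & forall B, within_nbhd r B A -> thin_at e B.
Proof.
move=> [s [d d0 [sde cov]]].
have S0 : (0 : R) < (size s).+1%:R by rewrite ltr0n.
pose r := (e / (size s).+1%:R - d) / 2.
have r0 : 0 < r by rewrite divr_gt0 // subr_gt0 ltr_pdivlMr // mulrC.
exists r => // B BA; exists s, (d + r); first by rewrite addr_gt0.
split=> [|b /BA[a Aa ba]].
  have : (size s).+1%:R * (e / (size s).+1%:R) = e by rewrite mulrC divfK // gt_eqF.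
  by rewrite /r; set q := e / _; nra.
have [c cs ca] := cov a Aa; exists c => //.
by apply: le_lt_trans (edistance_triangle a _ _) _; rewrite ltrD // edistanceC.
Qed.

(** Pass from [B] to a nearby point of [A], move inside [A], and return to [B]: the error grows by
    at most [2 r]. *)
Lemma spread_at_near e A i : spread_at e A i -> exists2 r, 0 < r &
  forall B, within_nbhd r B A -> within_nbhd r A B -> spread_at e B i.
Proof.
move=> [t [s [Nst tse sA]]].
have N0 : (0 : R) < N%:R by rewrite ltr0n (leq_trans _ (ltn_ord i)).
(* Errors below [s'] are admissible for [t]; the new error [s + 2 r] is the midpoint of [s] and
   [s']. *)
pose s' := Num.min (t / N%:R) (e - t).
have ss' : s < s' by rewrite lt_min ltr_pdivlMr // mulrC Nst; lra.
pose r := (s' - s) / 4.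
have r0 : 0 < r by rewrite divr_gt0 // subr_gt0.
exists r => // B BA AB; exists t, (s + 2 * r); split.
- have : N%:R * s' <= t by rewrite mulrC -ler_pdivlMr // ge_min lexx.
  by rewrite /r; nra.
- have : s' <= e - t by rewrite ge_min lexx orbT.
  by rewrite /r; lra.
- move=> b /BA[a Aa ba]; have [a' Aa' [c ct a's]] := sA a Aa.
  have [b' Bb' a'b'] := AB a' Aa'; exists b' => //; exists c => //.
  set v := c *: _ in a's *.
  have := edistance_triangle a' b' (b + v); have := edistance_triangle (a + v) a' (b + v).
  have -> : edistance (a + v) (b + v) = edistance b a.
    by rewrite edistanceC /edistance opprD addrACA subrr addr0.
  by rewrite (edistanceC b' a'); lra.
Qed.

Lemma closure_within r A : 0 < r -> within_nbhd r (closure A) A.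
Proof.
move=> r0 x clx; have [|y [Ay xy]] := clx [set y | edistance x y < r].
  by apply/nbhs_edistance; exists r.
by exists y.
Qed.

Lemma subset_within r A B : 0 < r -> A `<=` B -> within_nbhd r A B.
Proof. by move=> r0 AB x Ax; exists x; [exact: AB | rewrite edistancexx]. Qed.

Lemma thin_closure A : thin A -> thin (closure A).
Proof.
move=> tA e /tA /thin_at_near[r r0]; apply; exact: closure_within.
Qed.

Lemma spread_closure A : spread A -> spread (closure A).
Proof.
move=> sA e i /(sA _ i) /spread_at_near[r r0]; apply; first exact: closure_within.
exact/subset_within/subset_closure.
Qed.

Lemma within_trans r r' A B C : within_nbhd r A B -> within_nbhd r' B C ->
  within_nbhd (r + r') A C.
Proof.
move=> AB BC a /AB[b /BC[c Cc bc] ab]; exists c => //.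
by apply: le_lt_trans (edistance_triangle b _ _) _; rewrite ltrD.
Qed.

Lemma within_bounded r A B : within_nbhd r A B -> bounded_set B -> bounded_set A.
Proof.
move=> AB [M [_ hM]]; exists (M + 1 + r); split; first exact: num_real.
move=> K MK a /AB[b Bb ab].
have := hM (M + 1); rewrite ltrDl => /(_ ltr01 b Bb) /= bM.
have := norm_le_enorm (a - b); rewrite -/(edistance a b).
by have := ler_normD (a - b) b; rewrite subrK; lra.
Qed.

Lemma compact_net A r : compact A -> 0 < r ->
  exists2 s : seq 'rV[R]_N, {in s, forall x, A x} & within_nbhd r A [set` s].
Proof.
rewrite compact_cover => cA r0.
have [|x Ax|D' D'A Acov] := cA _ A (fun x => [set y | edistance x y < r]).
- move=> x _; rewrite openE => y /= xy; apply/nbhs_edistance.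
  exists (r - edistance x y); first by rewrite subr_gt0.
  by move=> z yz; apply: le_lt_trans (edistance_triangle y _ _) _; rewrite -ltrBrDl.
- by exists x => //=; rewrite edistancexx.
exists (finmap.enum_fset D') => [x /D'A|]; first by rewrite inE.
by move=> a /Acov[x /= xD xa]; exists x => //; rewrite edistanceC.
Qed.
End near.

(** * Sums of digits along the axes *)

Section digit_sums.
Variables (R : realType) (n : nat).
Implicit Types (F : seq 'rV[R]_n.+1) (b : nat -> bool) (e : R).

Definition cyclic_step l : 'rV[R]_n.+1 := 4 ^- l *: delta_mx 0 (inord (l %% n.+1)).

Definition digit_sum b m : 'rV[R]_n.+1 := \sum_(l < m) (b l)%:R *: cyclic_step l.

(** Vanishing of the first [k] bits keeps the set close to [F]. Only finite sums occur; limits enter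
    through the closure taken later. *)
Definition digit_set F k : set 'rV[R]_n.+1 :=
  [set x | exists f b m, [/\ f \in F, forall l, (l < k)%N -> ~~ b l
                           & x = f + digit_sum b m]].

Lemma eq_digit_sum b b' m : (forall l, (l < m)%N -> b l = b' l) ->
  digit_sum b m = digit_sum b' m.
Proof. by move=> bb'; apply: eq_bigr => l _; rewrite bb'. Qed.

Lemma digit_sum0 b m : (forall l, (l < m)%N -> ~~ b l) -> digit_sum b m = 0.
Proof. by move=> b0; apply: big1 => l _; rewrite (negPf (b0 l _)) ?scale0r. Qed.

(** Padding with zero bits lets sums of different lengths be compared term by term. *)
Lemma digit_sum_pad b m M :
  digit_sum b m = digit_sum (fun l => b l && (l < m)%N) (m + M).
Proof.
rewrite /digit_sum big_split_ord /= [X in _ + X]big1 ?addr0 => [|l _].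
  by apply: eq_bigr => l _; rewrite ltn_ord andbT.
by rewrite ltnNge leq_addr andbF scale0r.
Qed.

(** The bound telescopes, since a term has norm at most [4^-l <= 2 (4^-l - 4^-(l+1))]. *)
Lemma digit_sum_tail b M j :
  edistance (digit_sum b (M + j)) (digit_sum b M) <= 2 * (4 ^- M - 4 ^- (M + j)).
Proof.
elim: j => [|j IHj]; first by rewrite addn0 edistancexx subrr mulr0.
rewrite addnS; apply: le_trans (edistance_triangle (digit_sum b (M + j)) _ _) _.
apply: le_trans (lerD _ IHj) _; first exact: lexx.
have -> : edistance (digit_sum b (M + j).+1) (digit_sum b (M + j)) =
    (b (M + j)%N)%:R * 4 ^- (M + j).
  rewrite /edistance /digit_sum big_ord_recr /= addrAC subrr add0r scalerA.
  by rewrite enorm_scale_delta normrM !ger0_norm ?invr_ge0 ?exprn_ge0.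
have p0 : 0 < 4 ^- (M + j) :> R by rewrite invr_gt0 exprn_gt0.
rewrite exprSr invfM; set p := 4 ^- (M + j) in p0 *.
by case: (b _); rewrite ?mul1r ?mul0r; lra.
Qed.

Lemma digit_sum_near b m M b' : (forall l, (l < M)%N -> b' l = b l && (l < m)%N) ->
  edistance (digit_sum b' M) (digit_sum b m) < 3 * 4 ^- M.
Proof.
move=> bb'; rewrite (digit_sum_pad b m M) (eq_digit_sum bb') edistanceC addnC.
apply: le_lt_trans (digit_sum_tail _ _ _) _.
have p0 i : 0 < 4 ^- i :> R by rewrite invr_gt0 exprn_gt0.
by have := p0 M; have := p0 (M + m)%N; lra.
Qed.

Lemma digit_set_within F k : within_nbhd (3 * 4 ^- k) (digit_set F k) [set` F].
Proof.
move=> _ [f [b [m [fF bk ->]]]]; exists f => //.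
have := @digit_sum_near b m k (fun=> false); rewrite digit_sum0 // => h.
rewrite edistanceC /edistance opprD addrA subrr -[X in X - _]/0.
by apply: h => l /bk /negPf ->.
Qed.

Lemma sub_digit_set F k : [set` F] `<=` digit_set F k.
Proof.
move=> f fF; exists f, (fun=> false), 0%N; split=> //.
by rewrite /digit_sum big_ord0 addr0.
Qed.

Lemma thin_digit_set F k : thin (digit_set F k).
Proof.
move=> e e0.
(* With [size F * 2^M] balls of radius [3 * 4^-M], the quantity to bound is at most
   [3 (size F + 1) 2^-M]. The centres are the sums of the first [M] digits. *)
have [|M Me] := @exists_expVn_lt R 2 (e / (3 * (size F).+1%:R)) (lexx _).
  by rewrite divr_gt0 // mulr_gt0 ?ltr0n.
pose ext (g : {ffun 'I_M -> bool}) l := oapp g false (insub l).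
exists [seq f + digit_sum (ext g) M | f <- F, g <- enum {ffun 'I_M -> bool}].
exists (3 * 4 ^- M); first by rewrite mulr_gt0 ?invr_gt0 ?exprn_gt0.
split.
  rewrite size_allpairs -cardE card_ffun card_bool card_ord.
  have p0 : (0 : R) < 2 ^- M by rewrite invr_gt0 exprn_gt0.
  have p1 : (2 : R) ^+ M * 2 ^- M = 1 by rewrite divff // expf_neq0.
  have p2 : (2 : R) ^- M <= 1 by rewrite invf_le1 ?exprn_gt0 // exprn_ege1 // ler1n.
  rewrite (_ : 4 ^- M = 2 ^- M * 2 ^- M :> R); last first.
    by rewrite -invfM -exprMn -natrM.
  move: Me; rewrite ltr_pdivlMr ?mulr_gt0 ?ltr0n // => Me.
  rewrite -addn1 natrD natrM natrX; apply: le_lt_trans Me.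
  rewrite -[(size F).+1]addn1 natrD.
  set p := 2 ^- M in p0 p1 p2 *; set q := 2 ^+ M in p1 *.
  have -> : ((size F)%:R * q + 1) * (3 * (p * p)) =
    3 * p * ((size F)%:R * (q * p) + p) by ring.
  by rewrite p1; nra.
move=> _ [f [b [m [fF bk ->]]]].
pose g : {ffun 'I_M -> bool} := [ffun l : 'I_M => b l && (l < m)%N].
exists (f + digit_sum (ext g) M).
  by apply/allpairsP; exists (f, g); rewrite mem_enum.
rewrite /edistance opprD addrACA subrr add0r; apply: digit_sum_near => l lM.
by rewrite /ext insubT /= ffunE.
Qed.

Lemma spread_digit_set F k : spread (digit_set F k).
Proof.
move=> e i e0.
have four : (2 : R) <= 4 by lra.
have [|a ae] := @exists_expVn_lt R 4 (e / 2) four; first by rewrite divr_gt0.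
(* The residue [i] selects the axis, [l >= k] makes bit [l] free to flip, and [l >= a] makes the
   move short. *)
pose l := ((k + a) * n.+1 + i)%N.
have li : inord (l %% n.+1) = i by rewrite modnMDl modn_small // inord_val.
have kal : (k + a <= l)%N by rewrite /l; nia.
have p0 : (0 : R) < 4 ^- l by rewrite invr_gt0 exprn_gt0.
have pa : (4 : R) ^- l <= 4 ^- a.
  by rewrite lef_pV2 ?posrE ?exprn_gt0 // ler_eXn2l //; [lia | lra].
have n1 : (1 : R) <= n.+1%:R by rewrite ler1n.
set t : R := 4 ^- l in p0 pa *; set q : R := n.+1%:R in n1 *.
have q0 : q != 0 by rewrite gt_eqF //; lra.
have tq : q * (t / (2 * q)) = t / 2 by field.
have tq0 : 0 < t / (2 * q) by rewrite divr_gt0 //; lra.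
(* Flipping a bit moves the point exactly along the axis; the error bound only has to be positive
   and small enough. *)
exists t, (t / (2 * q)); split.
- by rewrite tq; lra.
- by move: tq tq0; set s := t / (2 * q); nra.
move=> _ [f [b [m [fF bk ->]]]].
(* [b1] is [b] cut off at [m], and [b2] flips its bit [l]; the length [m + l.+1] covers both [m] and
   [l]. *)
pose b1 := fun p => b p && (p < m)%N; pose b2 := fun p => b1 p (+) (p == l).
exists (f + digit_sum b2 (m + l.+1)).
  exists f, b2, (m + l.+1)%N; split=> // p pk; rewrite /b2 /b1 (negPf (bk _ pk)) /=.
  by rewrite neq_ltn; lia.
have lm : (l < m + l.+1)%N by lia.
exists (((b2 l)%:R - (b1 l)%:R) * t).
  rewrite normrM [X in _ * X]gtr0_norm // /b2 eqxx.
  by case: (b1 l); rewrite /= ?subr0 ?sub0r ?normrN normr1 mul1r.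
rewrite (digit_sum_pad b m l.+1) -/b1.
rewrite (_ : _ + _ *: _ = f + digit_sum b2 (m + l.+1)) ?edistancexx //.
rewrite -addrA; congr (_ + _).
rewrite /digit_sum (bigD1 (Ordinal lm)) //= [RHS](bigD1 (Ordinal lm)) //=.
rewrite addrAC; congr (_ + _).
  by rewrite -li -scalerA -scalerDl addrC subrK.
by apply: eq_bigr => p pl; rewrite /b2 (_ : (p == l :> nat) = false) ?addbF //; exact/negbTE.
Qed.
End digit_sums.

(** * The Hausdorff distance *)

Section hausdorff.
Variables (R : realType) (N : nat).
Implicit Types X Y : cantor_sets R N.

Lemma within_subset_nbhd_of (A B : set 'rV[R]_N) r : B !=set0 ->
  within_nbhd r A B <-> A `<=` nbhd_of B r.
Proof. by move=> B0; split=> AB a /AB /nbhd_ofP; apply. Qed.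

Lemma within_le r r' (A B : set 'rV[R]_N) : r <= r' ->
  within_nbhd r A B -> within_nbhd r' A B.
Proof.
by move=> rr' AB a /AB[b Bb ab]; exists b => //; exact: lt_le_trans rr'.
Qed.

Lemma compact_within (A B : set 'rV[R]_N) : compact A -> B !=set0 ->
  exists r, within_nbhd r A B.
Proof.
move=> cA [b Bb].
have : compact (edistance b @` A).
  by apply: continuous_compact cA; exact/continuous_subspaceT/edistance_continuous.
move=> /compact_bounded[M [_ hM]]; exists (M + 2) => a Aa; exists b => //.
rewrite edistanceC (le_lt_trans (ler_norm _)) // (@le_lt_trans _ _ (M + 1)) //.
  by apply: (hM (M + 1)); [rewrite ltrDl | exists a].
by rewrite ltrD2l ltr1n.
Qed.

Lemma mdist_ltP X Y r : mdist X Y < r -> within_nbhd r X Y /\ within_nbhd r Y X.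
Proof.
have X0 := cantor_set_nonempty (cantor_carrierP X).
have Y0 := cantor_set_nonempty (cantor_carrierP Y).
have [p XY] := compact_within (cantor_set_compact (cantor_carrierP X)) Y0.
have [q YX] := compact_within (cantor_set_compact (cantor_carrierP Y)) X0.
rewrite mdist_cantor_sets => /inf_lt -[]; last first.
  move=> t [_ /(within_subset_nbhd_of _ _ Y0) tXY /(within_subset_nbhd_of _ _ X0) tYX].
  by move=> /ltW tr; split; exact: within_le tr _.
(* The infimum is over a nonempty set: compactness gave [p] and [q], and 1 ensures positivity. *)
exists (Num.max 1 (Num.max p q)); split; first by rewrite lt_max ltr01.
  by apply/within_subset_nbhd_of => //; apply: within_le XY; rewrite !le_max lexx orbT.
by apply/within_subset_nbhd_of => //; apply: within_le YX; rewrite !le_max lexx !orbT.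
Qed.

Lemma mdist_le X Y r : 0 < r -> within_nbhd r X Y -> within_nbhd r Y X ->
  mdist X Y <= r.
Proof.
have X0 := cantor_set_nonempty (cantor_carrierP X).
have Y0 := cantor_set_nonempty (cantor_carrierP Y).
move=> r0 /(within_subset_nbhd_of _ _ Y0) XY /(within_subset_nbhd_of _ _ X0) YX.
by apply: ge_inf; [exists 0 => t [/ltW] | split].
Qed.
End hausdorff.

(** * The dense Gdelta set of thin and spread Cantor sets *)

Lemma orth_proj_fullv (R : realType) N (x : 'rV[R]_N) : orth_proj fullv x = x.
Proof.
apply: orth_proj_unique => [|z _]; first exact: memvf.
by rewrite subrr dot0l.
Qed.

Unset Implicit Arguments.

Theorem theorem1p1 (R : realType) (N : nat) (N_ge1 : (1 <= N)%N) :
  exists P : set (cantor_sets R N),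
    [/\ dense P, Gdelta P &
        forall X : cantor_sets R N, P X ->
          forall L : {vspace 'rV[R]_N}, L != 0%VS ->
            is_cantor_set R (orth_proj L @` X)].
Proof.
case: N N_ge1 => // n _.
pose U k : set (cantor_sets R n.+1) :=
  [set X | thin_at (2 ^- k) X /\ forall i, spread_at (2 ^- k) X i].
have thinP (X : cantor_sets R n.+1) : (\bigcap_k U k) X -> thin X.
  move=> PX e e0; have [k ke] := exists_expVn_lt (lexx 2) e0.
  have [[s [d d0 [sd cov]]] _] := PX k I.
  by exists s, d => //; split=> //; exact: lt_trans ke.
have spreadP (X : cantor_sets R n.+1) : (\bigcap_k U k) X -> spread X.
  move=> PX e i e0; have [k ke] := exists_expVn_lt (lexx 2) e0.
  have [_ /(_ i)[t [s [st ts sX]]]] := PX k I.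
  by exists t, s; split=> //; exact: lt_trans ke.
exists (\bigcap_k U k); split.
- move=> O [X OX] oO.
  have /nbhs_ballP[e /= e0 eO] : nbhs X O by exact: open_nbhs_nbhs.
  have cX := cantor_set_compact (cantor_carrierP X).
  (* The net and the digits, with [3 * 4^-k < e / 4], each deviate by less than [e / 4]; passing to
     the closure costs another [e / 4]. In either direction the total is at most [e / 2]. *)
  have e4 : 0 < e / 4 by rewrite divr_gt0.
  have [F FX XF] := compact_net cX e4.
  have e43 : 0 < e / 4 / 3 by rewrite divr_gt0.
  have four : (2 : R) <= 4 by rewrite ler_nat.
  have [k ke] := exists_expVn_lt four e43.
  pose D := digit_set F k.
  have DX : within_nbhd (e / 4) D X.
    move=> x /digit_set_within[f fF xf]; exists f; first exact: FX.
    by apply: lt_trans xf _; rewrite mulrC -ltr_pdivlMr.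
  have FD : [set` F] `<=` D := @sub_digit_set _ _ F k.
  have cX' : within_nbhd (e / 4 + e / 4) (closure D) X.
    by apply: within_trans DX; exact: closure_within.
  have Xc : within_nbhd (e / 4 + e / 4) X (closure D).
    apply: within_trans XF _; apply: subset_within => //.
    exact: subset_trans FD (@subset_closure _ _).
  have tZ := thin_closure (@thin_digit_set _ _ F k).
  have sZ := spread_closure (@spread_digit_set _ _ F k).
  have canZ : is_cantor_set R (closure D).
    (* Projecting to the whole space is the identity, so the projection result shows that
       [closure D] itself is a Cantor set. *)
    have := @cantor_orth_proj R n.+1 (closure D) fullv.
    rewrite (_ : orth_proj fullv @` _ = closure D); last first.
      apply/seteqP; split=> [_ [x Zx <-]|x Zx]; first by rewrite orth_proj_fullv.
      by exists x; rewrite ?orth_proj_fullv.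
    apply=> //.
    + have [x Xx] := cantor_set_nonempty (cantor_carrierP X).
      by have [y Dy _] := Xc x Xx; exists y.
    + apply: bounded_closed_compact; last exact: closed_closure.
      exact: within_bounded cX' (compact_bounded cX).
    + by rewrite -dimv_eq0 dimvf dim_matrix.
  pose Z := CantorSet canZ.
  exists Z; split; last first.
    move=> i _; split=> [|j]; [apply: tZ | apply: sZ];
      by rewrite invr_gt0 exprn_gt0.
  apply: eO; rewrite ballEmdist /=.
  apply: (@le_lt_trans _ _ (e / 4 + e / 4)); last by lra.
  by apply: mdist_le => //; lra.
- exists U => // k; rewrite openE => X [tX sX].
  have nbhsX (r : R) (Q : set (cantor_sets R n.+1)) : 0 < r ->
      (forall Y : cantor_sets R n.+1, within_nbhd r X Y -> within_nbhd r Y X -> Q Y) ->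
      nbhs X Q.
    move=> r0 rQ; apply/nbhs_ballP; exists r => //= Y.
    by rewrite ballEmdist => /mdist_ltP[]; exact: rQ.
  have tN : nbhs X [set Y : cantor_sets R n.+1 | thin_at (2 ^- k) Y].
    have [r r0 rP] := thin_at_near tX.
    by apply: (nbhsX r) => // Y _; exact: rP.
  have sN i : nbhs X [set Y : cantor_sets R n.+1 | spread_at (2 ^- k) Y i].
    have [r r0 rP] := spread_at_near (sX i).
    by apply: (nbhsX r) => // Y XY YX; exact: rP.
  (* There are finitely many axes, so the conditions hold together on a neighbourhood. *)
  exact: filterI tN (filter_forall _ sN).
- move=> X PX L L0; apply: cantor_orth_proj L0.
  + exact: cantor_set_nonempty (cantor_carrierP X).
  + exact: cantor_set_compact (cantor_carrierP X).
  + exact: thinP.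
  + exact: spreadP.
Qed.
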